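(* Let $n\in\mathbb{N}$. Let $\mathfrak{Y}_n$ be a measurable sample space with $\sigma$-finite reference measure $\mu_n$, $\Lambda_n$ a measurable natural parameter space and $q_n:\Lambda_n\times\mathfrak{Y}_n\to[0,\infty)$ a likelihood with $\int q_n(\lambda,y)\,\mu_n(dy)=1$ for all $\lambda\in\Lambda_n$. Let $\mathcal{M}_n$ be a countable index set, $\{\Theta_{n,m}\}_{m\in\mathcal{M}_n}$ a family of pairwise disjoint parameter spaces, $\Theta_{n,\mathcal{M}_n}:=\bigcup_{m}\Theta_{n,m}$, and $T_n:\Theta_{n,\mathcal{M}_n}\to\Lambda_n$ measurable. Let the prior be $\Pi_n=\sum_{m\in\mathcal{M}_n}\alpha_{n,m}\Pi_{n,m}$ with $(\alpha_{n,m})_m$ a probability vector and $\Pi_{n,m}$ a probability measure on $\Theta_{n,m}$, and let the variational family be $$\mathbb{V}_n=\Big\{\sum_{m\in\mathcal{M}_n}\gamma_{n,m}\Xi_{n,m}:(\gamma_{n,m})_m \text{ a probability vector},\ \Xi_{n,m}\in\mathbb{V}_{n,m}\Big\}$$ for given sets $\mathbb{V}_{n,m}$ of probability measures on $\Theta_{n,m}$. For an observation $Y^{(n)}$, let $$\widehat\Xi_{n,m}\in\operatorname*{argmin}_{\Xi\in\mathbb{V}_{n,m}}\mathcal{E}(\Xi,\Pi_{n,m},q_n,Y^{(n)}),\qquad \widehat\gamma_{n,m}=\frac{\alpha_{n,m}\exp\big(-\mathcal{E}(\widehat\Xi_{n,m},\Pi_{n,m},q_n,Y^{(n)})\big)}{\sum_{m'\in\mathcal{M}_n}\alpha_{n,m'}\exp\big(-\mathcal{E}(\widehat\Xi_{n,m'},\Pi_{n,m'},q_n,Y^{(n)})\big)}.$$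 Then the variational posterior $\widehat\Xi_n\in\operatorname{argmin}_{\Xi\in\mathbb{V}_n}\mathrm{KL}(\Xi,\Pi_n(\cdot\mid Y^{(n)}))$ is given by $\widehat\Xi_n=\sum_{m\in\mathcal{M}_n}\widehat\gamma_{n,m}\widehat\Xi_{n,m}$.
   Context: The posterior is $\Pi_n(\theta\in\mathcal{T}\mid Y^{(n)})=\int_{\mathcal{T}}q_n(T_n(\theta),Y^{(n)})\,d\Pi_n(\theta)/\int q_n(T_n(\theta),Y^{(n)})\,d\Pi_n(\theta)$. The variational objective is $\mathcal{E}(\Xi,\Pi,q_n,Y^{(n)}):=-\int\log q_n(T_n(\theta),Y^{(n)})\,d\Xi(\theta)+\mathrm{KL}(\Xi,\Pi)$, where $\mathrm{KL}(P_1,P_2)=\int\log(dP_1/dP_2)\,dP_1$ if $P_1\ll P_2$ and $+\infty$ otherwise. *)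

(* Defs.v *)
From HB Require Import structures.
From mathcomp Require Import all_boot all_order all_algebra.
From mathcomp Require Import all_classical all_reals all_analysis.
Set Implicit Arguments.
Unset Strict Implicit.
Unset Printing Implicit Defensive.
Import Order.TTheory GRing.Theory Num.Theory.
Local Open Scope classical_set_scope.
Local Open Scope ring_scope.

(* extended logarithm: log x = -oo for x <= 0 (only x = 0 matters here) *)
Definition elog {R : realType} (x : R) : \bar R :=
  if 0 < x then (ln x)%:E else -oo%E.

Definition KL {d} {T : measurableType d} {R : realType}
    (P1 P2 : probability T R) : \bar R :=
  if pselect (P1 `<< P2) then
    (\int[P1]_x elog (fine ((Radon_Nikodym (charge_of_finite_measure P1) P2) x)))%E
  else +oo%E.

Definition vobj {d dL dY} {Th : measurableType d} {Lam : measurableType dL}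
    {Yt : measurableType dY} {R : realType}
    (T : Th -> Lam) (q : Lam -> Yt -> R) (y : Yt)
    (Xi Pi : probability Th R) : \bar R :=
  (- (\int[Xi]_x elog (q (T x) y)) + KL Xi Pi)%E.

Definition prob_vector {R : realType} {M : countType} (w : M -> R) : Prop :=
  (forall m, 0 <= w m) /\ (\esum_(m in [set: M]) (w m)%:E = 1)%E.

Definition is_mixture {d} {Th : measurableType d} {R : realType} {M : countType}
    (w : M -> R) (P : M -> probability Th R) (Q : probability Th R) : Prop :=
  forall A, measurable A -> Q A = (\esum_(m in [set: M]) (w m)%:E * P m A)%E.

Definition var_family {d} {Th : measurableType d} {R : realType} {M : countType}
    (V : M -> set (probability Th R)) : set (probability Th R) :=
  [set Q | exists (w : M -> R) (P : M -> probability Th R),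
      [/\ prob_vector w, (forall m, V m (P m)) & is_mixture w P Q]].

Definition evidence {d dL dY} {Th : measurableType d} {Lam : measurableType dL}
    {Yt : measurableType dY} {R : realType}
    (T : Th -> Lam) (q : Lam -> Yt -> R) (y : Yt) (Pi : probability Th R)
    : \bar R :=
  (\int[Pi]_x (q (T x) y)%:E)%E.

Definition is_posterior {d dL dY} {Th : measurableType d} {Lam : measurableType dL}
    {Yt : measurableType dY} {R : realType}
    (T : Th -> Lam) (q : Lam -> Yt -> R) (y : Yt) (Pi Post : probability Th R)
    : Prop :=
  forall A, measurable A ->
    Post A = ((\int[Pi]_(x in A) (q (T x) y)%:E) *
              ((fine (evidence T q y Pi))^-1)%:E)%E.

Definition gamma_den {d dL dY} {Th : measurableType d} {Lam : measurableType dL}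
    {Yt : measurableType dY} {R : realType} {M : countType}
    (T : Th -> Lam) (q : Lam -> Yt -> R) (y : Yt) (alpha : M -> R)
    (PiM Xihat : M -> probability Th R) : \bar R :=
  (\esum_(m in [set: M]) (alpha m)%:E * expeR (- vobj T q y (Xihat m) (PiM m)))%E.

Definition gammahat {d dL dY} {Th : measurableType d} {Lam : measurableType dL}
    {Yt : measurableType dY} {R : realType} {M : countType}
    (T : Th -> Lam) (q : Lam -> Yt -> R) (y : Yt) (alpha : M -> R)
    (PiM Xihat : M -> probability Th R) (m : M) : R :=
  fine ((alpha m)%:E * expeR (- vobj T q y (Xihat m) (PiM m)))%E /
  fine (gamma_den T q y alpha PiM Xihat).

(* Main.v *)
(* Let r be the density of a mixture Xi = sum_m w_m P_m with respect to the
   posterior, and e(P) the objective of P with respect to the prior of its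
   component. On Theta_m the density of P_m with respect to the prior component
   is alpha_m / (w_m Z) * r * q, hence
     int ln r dP_m = e(P_m) - ln alpha_m + ln w_m + ln Z,
   and, since ln gamma_m = ln alpha_m - e(Xihat_m) - ln D,
     int ln r dP_m - (ln Z - ln D)
       = e(P_m) - e(Xihat_m) + ln (w_m / gamma_m) >= ln (w_m / gamma_m).
   Multiplying by w_m and using w ln (w / g) >= w - g, the sum over m gives
   KL(Xi, posterior) >= ln Z - ln D, with equality at the gamma-mixture of the
   Xihat_m. When some of the integrals are infinite, the identity for e(P_m)
   still holds as long as e(P_m) is not -oo: Young's inequality
   g ln q <= g ln g + q controls both parts of ln q. The value -oo, which is
   what the extended reals return for +oo - +oo, is excluded by D < +oo. *)

Require Import Defs.
From HB Require Import structures.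
From mathcomp Require Import all_boot all_order all_algebra.
From mathcomp Require Import all_classical all_reals all_analysis.
From mathcomp Require Import measurable_realfun lra.
Import Order.TTheory GRing.Theory Num.Theory.
Local Open Scope classical_set_scope.
Local Open Scope ring_scope.

(** * Densities between probability measures, and [KL] in terms of them *)

(** A real-valued function that is nonnegative everywhere, rather than an almost-everywhere class,
    so that products and logarithms can be handled pointwise. *)
Definition is_density {d} {T : measurableType d} {R : realType}
    (g : T -> R) (P Q : set T -> \bar R) : Prop :=
  [/\ measurable_fun [set: T] g, forall x, 0 <= g x &
      forall A, measurable A -> P A = (\int[Q]_(x in A) (g x)%:E)%E].

Lemma density_dominates {d} {T : measurableType d} {R : realType}
    {P Q : probability T R} {g : T -> R} : is_density g P Q -> P `<< Q.
Proof.
move=> [mg g0 PE]; apply/null_content_dominatesP => A mA QA.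
rewrite PE// null_set_integral//.
by apply/measurable_EFinP; exact: measurable_funS mg.
Qed.

(** The zero set of [g] has [P]-mass equal to an integral of zero. Hence the value of [ln] at 0 does
    not affect integrals against [P]. *)
Lemma density_gt0 {d} {T : measurableType d} {R : realType}
    {P Q : probability T R} {g : T -> R} : is_density g P Q ->
  {ae P, forall x, 0 < g x}.
Proof.
move=> [mg g0 PE].
have mZ : measurable (g @^-1` [set 0]).
  by rewrite -[X in measurable X]setTI; exact: mg.
exists (g @^-1` [set 0]); split => //.
  rewrite PE//; apply: integral0_eq => x /= gx0.
  by rewrite gx0.
move=> x /= /negP; rewrite -leNgt => gx.
by apply/eqP; rewrite eq_le gx g0.
Qed.

Lemma density_exists {d} {T : measurableType d} {R : realType}
    {P Q : probability T R} : P `<< Q -> exists g, is_density g P Q.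
Proof.
move=> PQ; pose f := Radon_Nikodym_SigmaFinite.f P Q.
have ff x : f x \is a fin_num by exact: Radon_Nikodym_SigmaFinite.f_fin_num.
exists (fine \o f); split.
- apply: measurableT_comp => //.
  exact: (measurable_int Q (Radon_Nikodym_SigmaFinite.f_integrable PQ)).
- by move=> x /=; rewrite fine_ge0// Radon_Nikodym_SigmaFinite.f_ge0.
- move=> A mA; rewrite (Radon_Nikodym_SigmaFinite.f_integral PQ)//.
  by apply: eq_integral => x _; rewrite /= fineK// ff.
Qed.

(** The change of variables is known for the Radon-Nikodym derivative; [g] agrees with it [Q]-almost
    everywhere, since both have the same integral over every measurable set. *)
Lemma density_change {d} {T : measurableType d} {R : realType}
    {P Q : probability T R} {g : T -> R} {h : T -> \bar R} {E : set T} :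
  is_density g P Q -> measurable E -> measurable_fun [set: T] h ->
  (forall x, 0 <= h x)%E ->
  (\int[P]_(x in E) h x = \int[Q]_(x in E) (h x * (g x)%:E))%E.
Proof.
move=> dg mE mh h0; have PQ := density_dominates dg.
rewrite -(Radon_Nikodym_SigmaFinite.change_of_variables PQ)//; last first.
  exact: measurable_funTS.
have fint := Radon_Nikodym_SigmaFinite.f_integrable PQ.
have [mg g0 PE] := dg.
apply: ae_eq_integral => //.
- apply: measurable_funTS; apply: emeasurable_funM => //.
  exact: (measurable_int Q fint).
- apply: measurable_funTS; apply: emeasurable_funM => //.
  exact/measurable_EFinP.
- apply: ae_eq_subset (@subsetT _ E) _.
  apply: ae_eqe_mul2l.
  apply: integral_ae_eq => //; first exact/measurable_EFinP.
  move=> A _ mA; rewrite -PE//.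
  by rewrite -(Radon_Nikodym_SigmaFinite.f_integral PQ).
Qed.

Lemma elogE {R : realType} (x : R) : 0 < x -> elog x = (ln x)%:E.
Proof. by rewrite /elog => ->. Qed.

Lemma measurable_elog {R : realType} :
  measurable_fun [set: R] (@elog R).
Proof.
apply: measurable_fun_ifT => //.
  by apply: measurable_fun_ltr => //; exact: measurable_cst.
by apply/measurable_EFinP; exact: measurable_ln.
Qed.

(** The derivative chosen in [KL] equals [g] outside a [Q]-null set, which is [P]-null by
    domination, and [g] is positive [P]-almost everywhere, where [elog] and [ln] coincide. *)
Lemma KL_density {d} {T : measurableType d} {R : realType}
    {P Q : probability T R} {g : T -> R} : is_density g P Q ->
  KL P Q = (\int[P]_x (ln (g x))%:E)%E.
Proof.
move=> dg; have PQ := density_dominates dg; rewrite /KL.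
case: pselect => // PQ'.
have [mg g0 PE] := dg.
have fint := @Radon_Nikodym_integrable _ _ _ (charge_of_finite_measure P) Q PQ.
apply: ae_eq_integral => //.
- apply: measurableT_comp; first exact: measurable_elog.
  apply: measurableT_comp => //; exact: (measurable_int Q fint).
- apply/measurable_EFinP; exact: (measurableT_comp (@measurable_ln R) mg).
have fg : ae_eq Q [set: T]
    (Radon_Nikodym (charge_of_finite_measure P) Q) (EFin \o g).
  apply: integral_ae_eq => //; first exact/measurable_EFinP.
  move=> E _ mE; rewrite -PE//.
  by rewrite -(@Radon_Nikodym_integral _ _ _ (charge_of_finite_measure P) Q _ PQ).
have := null_dominates_ae_eq measurableT PQ fg.
apply: filterS2 (density_gt0 dg) => x gx /(_ I) /= fgx _.
by rewrite fgx /= elogE.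
Qed.

(** * Logarithmic integrals with possibly infinite values *)

Lemma ae_eq_integral_funeneg {d} {T : measurableType d} {R : realType}
    {P : probability T R} {f g : T -> \bar R} :
  measurable_fun [set: T] f -> measurable_fun [set: T] g ->
  ae_eq P [set: T] f g ->
  (\int[P]_x (f^\- x) = \int[P]_x (g^\- x))%E.
Proof.
move=> mf mg fg; apply: ge0_ae_eq_integral => //.
- exact: measurable_funeneg.
- exact: measurable_funeneg.
- by apply: filterS fg => x /(_ I) fgx _; rewrite !funenegE fgx.
Qed.

(** When [g] and [ln q] are positive, this follows from [ln (q / g) < q / g] multiplied by [g]. With
    positive parts, both sides are nonnegative and can always be integrated. *)
Lemma ln_young {R : realType} {g q : R} : 0 <= g -> 0 <= q ->
  g * Num.max (ln q) 0 <= g * Num.max (ln g) 0 + q.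
Proof.
move=> g0 q0; have [<-|gn0] := eqVneq 0 g; first by rewrite !mul0r add0r.
have gp : 0 < g by rewrite lt0r eq_sym gn0.
have m0 : 0 <= g * Num.max (ln g) 0.
  by rewrite mulr_ge0// le_max lexx orbT.
have [lq|lq] := leP (ln q) 0; first by rewrite mulr0 addr_ge0.
have qp : 0 < q.
  by rewrite lt0r q0 andbT; apply: contraL lq => /eqP ->; rewrite ln0// ltxx.
have := @ln_sublinear _ (q / g) (divr_gt0 qp gp).
rewrite ln_div ?posrE// ltrBlDr => /ltW.
rewrite -(ler_pM2l gp) mulrDr mulrCA divff ?gt_eqF// mulr1 addrC => /le_trans.
by apply; rewrite lerD2r ler_wpM2l// le_max lexx.
Qed.

(** Against [Q] the integrand is [g] times the negative part of [ln g], at most 1 because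
    [ln (1 / g) <= 1 / g]. So a divergence may be infinite but is never indeterminate. *)
Lemma density_ln_neg_lty {d} {T : measurableType d} {R : realType}
    {P Q : probability T R} {g : T -> R} : is_density g P Q ->
  (\int[P]_x ((EFin \o (@ln R \o g))^\- x) < +oo)%E.
Proof.
move=> dg; have [mg g0 _] := dg.
have ml : measurable_fun [set: T] (EFin \o (@ln R \o g)).
  apply/measurable_EFinP; exact: (measurableT_comp (@measurable_ln R) mg).
rewrite (density_change dg)//; last exact: measurable_funeneg.
apply: (@le_lt_trans _ _ (\int[Q]_x (cst 1%E x))%E); last first.
  rewrite integral_cst// mul1e.
  by rewrite [X in (X < _)%E](@probability_setT _ _ _ Q) ltry.
apply: ge0_le_integral => //.
- by move=> x _; rewrite mule_ge0// lee_fin.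
- apply: emeasurable_funM; [exact: measurable_funeneg|exact/measurable_EFinP].
move=> x _; rewrite /= funerneg /= -EFinM lee_fin /funrneg /=.
have [gx|gx] := leP (g x) 0.
  by rewrite ln0// oppr0 maxxx mul0r.
have := @ln_young _ 1 (g x)^-1 ler01.
rewrite lnV ?posrE// ln1 maxxx mul1r mulr0 add0r invr_ge0 => /(_ (ltW gx)).
by rewrite -(ler_pM2r gx) mulVf ?gt_eqF//.
Qed.

Lemma integrable_funeposneg {d} {T : measurableType d} {R : realType}
    {P : {measure set T -> \bar R}} {f : T -> \bar R} :
  measurable_fun [set: T] f -> (\int[P]_x (f^\+ x) < +oo)%E ->
  (\int[P]_x (f^\- x) < +oo)%E -> P.-integrable [set: T] f.
Proof.
move=> mf fp fn; apply/integrableP; split => //.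
rewrite -[X in (\int[P]_x X x)%E]/(abse \o f) fune_abse ge0_integralD//.
- exact: lte_add_pinfty.
- exact: measurable_funepos.
- exact: measurable_funeneg.
Qed.

(** The convention that [+oo - +oo] is [-oo] lets the negative part decide alone. *)
Lemma integral_eqNy {d} {T : measurableType d} {R : realType}
    {P : {measure set T -> \bar R}} {f : T -> \bar R} :
  ~~ (\int[P]_x (f^\- x) < +oo)%E -> (\int[P]_x f x = -oo)%E.
Proof.
by rewrite ltey negbK [X in _ -> X = _]integralE => /eqP ->; rewrite addeC.
Qed.

Lemma integral_eqy {d} {T : measurableType d} {R : realType}
    {P : {measure set T -> \bar R}} {f : T -> \bar R} :
  ~~ (\int[P]_x (f^\+ x) < +oo)%E -> (\int[P]_x (f^\- x) < +oo)%E ->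
  (\int[P]_x f x = +oo)%E.
Proof.
rewrite ltey negbK [X in _ -> _ -> X = _]integralE => /eqP -> fn.
by rewrite addye// eqe_oppLR/= lt_eqF.
Qed.

(* The bounds on [b] are what entropy (Young) inequalities provide; they rule
   out every indeterminate form except the one excluded by the last
   hypothesis. *)
Lemma integral_log_cancel {d} {T : measurableType d} {R : realType}
    {P : probability T R} {a b : T -> R} {k C C' : R} :
  measurable_fun [set: T] a -> measurable_fun [set: T] b ->
  let c := fun x => a x + b x + k in
  (\int[P]_x ((EFin \o a)^\- x) < +oo)%E ->
  (\int[P]_x ((EFin \o c)^\- x) < +oo)%E ->
  (\int[P]_x ((EFin \o b)^\- x) <= \int[P]_x ((EFin \o a)^\+ x) + C%:E)%E ->
  (\int[P]_x ((EFin \o b)^\+ x) <= \int[P]_x ((EFin \o c)^\+ x) + C'%:E)%E ->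
  (- (\int[P]_x (b x)%:E) + \int[P]_x (c x)%:E != -oo)%E ->
  (\int[P]_x (a x)%:E =
    - (\int[P]_x (b x)%:E) + \int[P]_x (c x)%:E - k%:E)%E.
Proof.
move=> ma mb c an cn bn bp.
have mc : measurable_fun [set: T] c.
  by apply: measurable_funD => //; exact: measurable_funD.
have ia := @integrable_funeposneg _ _ _ P _ (proj2 (measurable_EFinP _ _) ma).
have ib := @integrable_funeposneg _ _ _ P _ (proj2 (measurable_EFinP _ _) mb).
have ic := @integrable_funeposneg _ _ _ P _ (proj2 (measurable_EFinP _ _) mc).
have ik : P.-integrable [set: T] (EFin \o cst k).
  exact: finite_measure_integrable_cst.
have intk : (\int[P]_x (k%:E) = k%:E)%E.
  by rewrite integral_cst// [X in (_ * X)%E](@probability_setT _ _ _ P) mule1.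
have [cp|cp] := boolP (\int[P]_x ((EFin \o c)^\+ x) < +oo)%E.
  have {}ic := ic cp cn.
  have {}bp : (\int[P]_x ((EFin \o b)^\+ x) < +oo)%E.
    by rewrite (le_lt_trans bp)// lte_add_pinfty// ltry.
  have finc : (\int[P]_x (c x)%:E)%E \is a fin_num.
    exact: (integrable_fin_num measurableT ic).
  have [bn'|bn'] := boolP (\int[P]_x ((EFin \o b)^\- x) < +oo)%E.
    move=> _; have {}ib := ib bp bn'.
    have finb := integrable_fin_num measurableT ib.
    transitivity (\int[P]_x ((c x)%:E - (b x)%:E - k%:E))%E.
      apply: eq_integral => x _; rewrite -!EFinB; congr EFin.
      by rewrite /c addrAC addrK addrK.
    rewrite integralB//; last exact: integrableB.
    by rewrite integralB// intk; congr (_ - _)%E; rewrite addeC.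
  (* By [bn], an infinite negative part of [b] forces an infinite positive part of [a]; both sides
     are then [+oo]. *)
  have ap : ~~ (\int[P]_x ((EFin \o a)^\+ x) < +oo)%E.
    apply: contra bn' => ap.
    by rewrite (le_lt_trans bn)// lte_add_pinfty// ltry.
  rewrite (integral_eqNy bn') (integral_eqy ap an) => _ /=.
  by rewrite -(fineK finc).
(* Now [c] integrates to [+oo], so the last hypothesis keeps the integral of [b] away from [+oo] and
   the right side is [+oo]. A finite positive part of [a] would make [a] and [b], hence [c],
   integrable. *)
rewrite (integral_eqy cp cn) => bfin.
have {}bfin : (\int[P]_x (b x)%:E != +oo)%E.
  by apply: contra bfin => /eqP ->.
rewrite addey//; last by case: (\int[P]_x (b x)%:E)%E bfin.
rewrite addye//; apply: integral_eqy => //.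
apply: contra cp => ap; have {}ia := ia ap an.
have {}bn : (\int[P]_x ((EFin \o b)^\- x) < +oo)%E.
  by rewrite (le_lt_trans bn)// lte_add_pinfty// ltry.
have {}ib : P.-integrable [set: T] (EFin \o b).
  apply: ib => //; apply: contraT => bp'; move: bfin.
  by rewrite (integral_eqy bp' bn).
rewrite -ge0_fin_numE; last exact: integral_ge0.
apply: integrable_pos_fin_num => //.
exact: (integrableD measurableT (integrableD measurableT ia ib) ik).
Qed.

(** Shaped for [ln_young], whose error term carries no factor [g] and is therefore integrated
    against [Q] instead of [P]. *)
Lemma density_le_integral {d} {T : measurableType d} {R : realType}
    {P Q : probability T R} {g h1 h2 e : T -> R} : is_density g P Q ->
  measurable_fun [set: T] h1 -> measurable_fun [set: T] h2 ->
  measurable_fun [set: T] e ->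
  (forall x, 0 <= h1 x) -> (forall x, 0 <= h2 x) -> (forall x, 0 <= e x) ->
  (forall x, h1 x * g x <= h2 x * g x + e x) ->
  (\int[P]_x (h1 x)%:E <= \int[P]_x (h2 x)%:E + \int[Q]_x (e x)%:E)%E.
Proof.
move=> dg mh1 mh2 me h10 h20 e0 le12; have [mg g0 _] := dg.
have mf (h : T -> R) : measurable_fun [set: T] h ->
    measurable_fun [set: T] (fun x => (h x)%:E * (g x)%:E)%E.
  by move=> mh; apply/measurable_EFinP; exact: measurable_funM.
rewrite !(density_change dg)//; [|exact/measurable_EFinP..].
rewrite -ge0_integralD//.
- apply: ge0_le_integral => //.
  + by move=> x _; rewrite mule_ge0 ?lee_fin.
  + exact: mf.
  + by apply: emeasurable_funD; [exact: mf|exact/measurable_EFinP].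
  + by move=> x _; rewrite -!EFinM -EFinD lee_fin.
- by move=> x _; rewrite mule_ge0 ?lee_fin.
- exact: mf.
- by move=> x _; rewrite lee_fin.
- exact/measurable_EFinP.
Qed.

(** * The objective as the integral of a log-density *)

(** The log-density of [P] is [ln r + ln q + ln k]. It integrates to the divergence, and removing
    the integral of [ln q] leaves the objective. *)
Lemma vobj_log_density {d dL dY} {Th : measurableType d}
    {Lam : measurableType dL} {Yt : measurableType dY} {R : realType}
    {T : Th -> Lam} {q : Lam -> Yt -> R} {y : Yt} {P Q : probability Th R}
    {r : Th -> R} {k : R} :
  measurable_fun [set: Th] (fun x => q (T x) y) ->
  (forall x, 0 <= q (T x) y) ->
  (\int[Q]_x (q (T x) y)%:E < +oo)%E ->
  0 < k -> measurable_fun [set: Th] r -> (forall x, 0 <= r x) ->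
  is_density (fun x => k * (r x * q (T x) y)) P Q ->
  (\int[P]_x ((EFin \o (@ln R \o r))^\- x) < +oo)%E ->
  vobj T q y P Q != -oo%E ->
  (\int[P]_x (ln (r x))%:E = vobj T q y P Q - (ln k)%:E)%E.
Proof.
set p := fun x => q (T x) y; move=> mp p0 intp k0 mr r0 dg an.
pose g x := k * (r x * p x); pose a := @ln R \o r; pose b := @ln R \o p.
have ma : measurable_fun [set: Th] a := measurableT_comp (@measurable_ln R) mr.
have mb : measurable_fun [set: Th] b := measurableT_comp (@measurable_ln R) mp.
have mg : measurable_fun [set: Th] g by case: dg.
have g0 x : 0 <= g x by case: dg => _ + _; exact.
have mlg : measurable_fun [set: Th] (@ln R \o g).
  exact: (measurableT_comp (@measurable_ln R) mg).
pose c x := a x + b x + ln k.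
have mc : measurable_fun [set: Th] c.
  by apply: measurable_funD => //; exact: measurable_funD.
(* This permits replacing [elog] by [ln] and splitting the logarithm of the product. *)
have aepos : {ae P, forall x, 0 < r x /\ 0 < p x}.
  apply: filterS (density_gt0 dg) => x; rewrite -/(p x) pmulr_rgt0// => rp.
  have [rx px] : r x != 0 /\ p x != 0.
    by split; apply: contraTN rp => /eqP ->; rewrite ?mul0r ?mulr0 ltxx.
  by rewrite !lt_neqAle !(eq_sym 0) rx px r0 /p p0.
have aeb : ae_eq P [set: Th] (fun x => elog (p x)) (EFin \o b).
  by apply: filterS aepos => x [_ px] _; rewrite elogE.
have aec : ae_eq P [set: Th] (EFin \o (@ln R \o g)) (EFin \o c).
  apply: filterS aepos => x [rx px] _ /=; congr EFin.
  rewrite /g !lnM ?posrE//; last by rewrite mulr_gt0.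
  by rewrite /c addrC.
have mE (f : Th -> R) : measurable_fun [set: Th] f ->
    measurable_fun [set: Th] (@EFin R \o f).
  by move=> ?; exact/measurable_EFinP.
have -> : vobj T q y P Q = (- (\int[P]_x (b x)%:E) + \int[P]_x (c x)%:E)%E.
  rewrite /vobj; congr (- _ + _)%E.
    apply: ae_eq_integral => //; last exact: mE.
    exact: (measurableT_comp measurable_elog mp).
  rewrite (KL_density dg); apply: ae_eq_integral => //; exact: mE.
have cn : (\int[P]_x ((EFin \o c)^\- x) < +oo)%E.
  rewrite -(ae_eq_integral_funeneg _ _ aec); try exact: mE.
  exact: density_ln_neg_lty dg.
have cp : (\int[P]_x ((EFin \o c)^\+ x) =
    \int[P]_x ((EFin \o (@ln R \o g))^\+ x))%E.
  apply: ge0_ae_eq_integral => //.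
  - by apply: measurable_funepos; exact: mE.
  - by apply: measurable_funepos; exact: mE.
  - by apply: filterS aec => x /(_ I) cx _; rewrite !funeposE cx.
(* Both constants are error terms of Young's inequality integrated against [Q]: the constant
   function [k] and the likelihood. *)
apply: (@integral_log_cancel _ _ _ _ a b (ln k) k
  (fine (\int[Q]_x (p x)%:E)%E)) => //.
- rewrite funerneg funerpos.
  have -> : (k%:E = \int[Q]_x (cst k x)%:E)%E.
    by rewrite -[LHS]mule1 -(@probability_setT _ _ _ Q) -integral_cst.
  apply: (density_le_integral dg) => //.
  + exact: measurable_funrneg.
  + exact: measurable_funrpos.
  + by move=> x /=; exact: ltW.
  move=> x /=; have [px|px] := leP (p x) 0.
    have -> : q (T x) y = 0 by apply/eqP; rewrite eq_le px p0.
    by rewrite !mulr0 add0r ltW.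
  have pi0 : 0 <= (p x)^-1 by rewrite invr_ge0 ltW.
  (* Multiplied by [k * p x], Young's inequality for [r] and [1 / p] has the density as weight and
     [k] as error. *)
  have := ln_young (r0 x) pi0.
  rewrite lnV ?posrE// -(ler_pM2r (mulr_gt0 k0 px)) mulrDl.
  rewrite [X in _ + X]mulrCA mulVf ?gt_eqF// mulr1.
  rewrite /funrneg /funrpos /a /b /= -/(p x).
  by move: (Num.max _ _) (Num.max _ _) => u v; lra.
- rewrite cp fineK; last first.
    by rewrite ge0_fin_numE//; apply: integral_ge0 => x _; rewrite lee_fin p0.
  rewrite !funerpos; apply: (density_le_integral dg) => //.
  + exact: measurable_funrpos.
  + exact: measurable_funrpos.
  move=> x; rewrite mulrC [X in X + _]mulrC.
  by have := ln_young (g0 x) (p0 x); apply.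
Qed.

(** * Countable mixtures *)

Lemma esum_pickle {R : realType} {M : countType} {f : M -> \bar R} :
  (forall m, (0 <= f m)%E) ->
  (\esum_(m in [set: M]) f m =
   \sum_(0 <= n <oo) (if @pickle_inv M n is Some m then f m else 0))%E.
Proof.
move=> f0; rewrite nneseries_esumT; last by move=> n; case: pickle_inv.
pose F n := (if @pickle_inv M n is Some m then f m else 0)%E.
transitivity (\esum_(n in range (@pickle M)) F n)%E.
  rewrite esum_image; last first.
    by move=> m m' _ _; exact: (pcan_inj (@pickleK_inv M)).
  by apply: eq_esum => m _; rewrite /F pickleK_inv.
rewrite esum_mkcond; apply: eq_esum => n _; case: ifPn => // nM.
rewrite /F; case E : (pickle_inv n) => [m|//].
move: nM; rewrite notin_setE => -[]; exists m => //.
by have := @pickle_invK M n; rewrite E.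
Qed.

Definition mixture_terms {d} {Th : measurableType d} {R : realType}
    {M : countType} (w : M -> {nonneg R}) (P : M -> probability Th R)
    (n : nat) : {measure set Th -> \bar R} :=
  if @pickle_inv M n is Some m then mscale (w m) (P m) else mzero.

Definition mixture_measure {d} {Th : measurableType d} {R : realType}
    {M : countType} (w : M -> {nonneg R}) (P : M -> probability Th R)
  : {measure set Th -> \bar R} := mseries (mixture_terms w P) 0.

Lemma mixture_measureE {d} {Th : measurableType d} {R : realType}
    {M : countType} (w : M -> {nonneg R}) (P : M -> probability Th R) A :
  (mixture_measure w P A = \esum_(m in [set: M]) (w m)%:num%:E * P m A)%E.
Proof.
rewrite esum_pickle; last by move=> m; rewrite mule_ge0.
apply: eq_eseriesr => n _; rewrite /mixture_terms.
by case: pickle_inv.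
Qed.

Lemma ge0_integral_mixture {d} {Th : measurableType d} {R : realType}
    {M : countType} {w : M -> R} {P : M -> probability Th R}
    {Q : probability Th R} {f : Th -> \bar R} {D : set Th} :
  (forall m, 0 <= w m) -> is_mixture w P Q ->
  measurable D -> measurable_fun [set: Th] f -> (forall x, (0 <= f x)%E) ->
  (\int[Q]_(x in D) f x =
   \esum_(m in [set: M]) (w m)%:E * \int[P m]_(x in D) f x)%E.
Proof.
move=> w0 QE mD /(measurable_funS measurableT (@subsetT _ D)) mf f0.
pose w' m := NngNum (w0 m).
rewrite (eq_measure_integral (mixture_measure w' P)); last first.
  by move=> A mA _; rewrite mixture_measureE; exact: QE.
rewrite esum_pickle; last first.
  by move=> m; rewrite mule_ge0 ?lee_fin ?integral_ge0.
rewrite ge0_integral_measure_series//.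
apply: eq_eseriesr => n _; rewrite /mixture_terms.
case: pickle_inv => [m|]; last by rewrite integral_measure_zero.
exact: ge0_integral_mscale.
Qed.

Lemma mixture_exists {d} {Th : measurableType d} {R : realType}
    {M : countType} (w : M -> R) (P : M -> probability Th R) :
  prob_vector w -> exists Q : probability Th R, is_mixture w P Q.
Proof.
move=> [w0 w1]; pose mu := mixture_measure (fun m => NngNum (w0 m)) P.
have muT : mu [set: Th] = 1%E.
  rewrite mixture_measureE -[RHS]w1; apply: eq_esum => m _.
  by rewrite probability_setT mule1.
pose Qm := Measure_isProbability.Build _ _ _
  (mseries (mixture_terms (fun m => NngNum (w0 m)) P) 0) muT.
pose Q : probability Th R := HB.pack
  (mseries (mixture_terms (fun m => NngNum (w0 m)) P) 0) Qm.
by exists Q => A mA; rewrite -[LHS]/(mu A) mixture_measureE.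
Qed.

Lemma esumZl {R : realType} {M : countType} {f : M -> \bar R} {r : R} :
  0 <= r -> (forall m, (0 <= f m)%E) ->
  (\esum_(m in [set: M]) r%:E * f m = r%:E * \esum_(m in [set: M]) f m)%E.
Proof.
move=> r0 f0; rewrite !esum_pickle//; last first.
  by move=> m; rewrite mule_ge0 ?lee_fin.
rewrite -nneseriesZl; last by move=> n _; case: pickle_inv.
by apply: eq_eseriesr => n _; case: pickle_inv => //; rewrite mule0.
Qed.

Lemma esum_support1 {R : realType} {M : choiceType} {f : M -> \bar R} {m : M} :
  (0 <= f m)%E -> (forall k, k != m -> f k = 0%E) ->
  (\esum_(k in [set: M]) f k = f m)%E.
Proof.
move=> f0 fk; rewrite -[RHS](esum_set1 f0) [RHS]esum_mkcond.
apply: eq_esum => k _; case: ifPn => //.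
by rewrite notin_setE => /= /eqP/fk.
Qed.

Lemma esum_ge_term {R : realType} {M : choiceType} (f : M -> \bar R) (m : M) :
  (f m <= \esum_(k in [set: M]) f k)%E.
Proof.
apply: esum_ge; exists [set m]; last by rewrite fsbig_set1.
by split => //; exact: finite_set1.
Qed.

(** By disjointness [Theta m] is null for every other [P k], so one term of the mixture sum
    survives; there the restriction to [Theta m] changes nothing, as its complement is
    [P m]-null. *)
Lemma integral_mixture_component {d} {Th : measurableType d} {R : realType}
    {M : countType} {Theta : M -> set Th} {w : M -> R}
    {P : M -> probability Th R} {Q : probability Th R} {f : Th -> \bar R}
    {A : set Th} {m : M} :
  (forall k, measurable (Theta k)) -> trivIset [set: M] Theta ->
  (forall k, P k (Theta k) = 1%E) ->
  (forall k, 0 <= w k) -> is_mixture w P Q ->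
  measurable A -> measurable_fun [set: Th] f -> (forall x, (0 <= f x)%E) ->
  (\int[Q]_(x in A `&` Theta m) f x = (w m)%:E * \int[P m]_(x in A) f x)%E.
Proof.
move=> mTheta dTheta PTheta w0 QE mA mf f0.
have PC k : P k (~` Theta k) = 0%E by rewrite probability_setC// PTheta subee.
have mAm := measurableI _ _ mA (mTheta m).
rewrite (ge0_integral_mixture w0 QE)//.
transitivity ((w m)%:E * \int[P m]_(x in A `&` Theta m) f x)%E; last first.
  congr (_ * _)%E.
  rewrite [RHS](ge0_negligible_integral (measurableC (mTheta m)))//.
  - by rewrite setDE setCK.
  - exact: measurable_funTS.
  - exact: PC.
pose F k := ((w k)%:E * \int[P k]_(x in A `&` Theta m) f x)%E.
apply: (@esum_support1 _ _ F m); rewrite /F.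
  by rewrite mule_ge0 ?lee_fin ?integral_ge0.
move=> k km; rewrite null_set_integral ?mule0//; first exact: measurable_funTS.
apply/eqP; rewrite eq_le measure_ge0 andbT -(PC k) le_measure ?inE//.
  exact: measurableC.
move=> x [_ mx] kx; move/trivIsetP : dTheta => /(_ k m I I km).
by rewrite -subset0 => /(_ x); apply.
Qed.

Lemma mixture_component {d} {Th : measurableType d} {R : realType}
    {M : countType} {Theta : M -> set Th} {w : M -> R}
    {P : M -> probability Th R} {Q : probability Th R} {A : set Th} {m : M} :
  (forall k, measurable (Theta k)) -> trivIset [set: M] Theta ->
  (forall k, P k (Theta k) = 1%E) ->
  (forall k, 0 <= w k) -> is_mixture w P Q -> measurable A ->
  (Q (A `&` Theta m) = (w m)%:E * P m A)%E.
Proof.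
move=> mTheta dTheta PTheta w0 QE mA.
have := @integral_mixture_component _ _ _ _ _ _ _ _ (cst 1%E) _ m mTheta dTheta
  PTheta w0 QE mA (measurable_cst _) (fun=> lee01).
rewrite !integral_cst//; last exact: measurableI.
by rewrite !mul1e.
Qed.

(** * Densities relative to the prior and its components *)

Lemma posterior_density {d dL dY} {Th : measurableType d}
    {Lam : measurableType dL} {Yt : measurableType dY} {R : realType}
    {T : Th -> Lam} {q : Lam -> Yt -> R} {y : Yt} {Pi Post : probability Th R} :
  measurable_fun [set: Th] (fun x => q (T x) y) ->
  (forall x, 0 <= q (T x) y) ->
  is_posterior T q y Pi Post ->
  is_density (fun x => (fine (evidence T q y Pi))^-1 * q (T x) y) Post Pi.
Proof.
move=> mp p0 PostE.
have Z0 : 0 <= (fine (evidence T q y Pi))^-1.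
  by rewrite invr_ge0 fine_ge0// integral_ge0// => x _; rewrite lee_fin.
split.
- exact: measurable_funM.
- by move=> x; rewrite mulr_ge0.
- move=> A mA; rewrite PostE// muleC -ge0_integralZl_EFin//.
  + by move=> x _; rewrite lee_fin.
  + by apply/measurable_EFinP; exact: measurable_funTS.
Qed.

(** The [Xi]-mass of [A] inside [Theta m] is [w m * P m A]. Following the densities from [Xi] to
    [Post] to [Pi] and then to [PiM m] evaluates it a second time; dividing by [w m] gives the
    constant. *)
Lemma component_density {d dL dY} {Th : measurableType d}
    {Lam : measurableType dL} {Yt : measurableType dY} {R : realType}
    {T : Th -> Lam} {q : Lam -> Yt -> R} {y : Yt}
    {M : countType} {Theta : M -> set Th} {alpha w : M -> R}
    {PiM P : M -> probability Th R} {Pi Post Xi : probability Th R}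
    {r : Th -> R} {m : M} :
  measurable_fun [set: Th] (fun x => q (T x) y) ->
  (forall x, 0 <= q (T x) y) ->
  (forall k, measurable (Theta k)) -> trivIset [set: M] Theta ->
  (forall k, PiM k (Theta k) = 1%E) -> (forall k, P k (Theta k) = 1%E) ->
  (forall k, 0 <= alpha k) -> (forall k, 0 <= w k) ->
  is_mixture alpha PiM Pi -> is_mixture w P Xi ->
  is_posterior T q y Pi Post -> is_density r Xi Post ->
  0 < w m ->
  is_density
    (fun x => alpha m / (w m * fine (evidence T q y Pi)) * (r x * q (T x) y))
    (P m) (PiM m).
Proof.
move=> mp p0 mTheta dTheta PiTheta PTheta alpha0 w0 PiE XiE hPost hr wm.
have [mr r0 XiE'] := hr; have dPost := posterior_density mp p0 hPost.
set Z := fine _ in dPost *.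
have Z0 : 0 <= Z^-1.
  by rewrite invr_ge0 fine_ge0// integral_ge0// => x _; rewrite lee_fin.
have k0 : 0 <= alpha m / (w m * Z).
  by rewrite invfM !mulr_ge0// invr_ge0.
have mrp : measurable_fun [set: Th] (fun x => r x * q (T x) y).
  exact: measurable_funM.
split.
- exact: measurable_funM.
- by move=> x; exact: mulr_ge0 k0 (mulr_ge0 (r0 x) (p0 x)).
move=> A mA.
have mAm := measurableI _ _ mA (mTheta m).
have : ((w m)%:E * P m A =
    (alpha m)%:E * \int[PiM m]_(x in A) (Z^-1 * (r x * q (T x) y))%:E)%E.
  rewrite -(mixture_component mTheta dTheta PTheta w0 XiE)// XiE'//.
  have mr' : measurable_fun [set: Th] (EFin \o r) by exact/measurable_EFinP.
  rewrite (density_change dPost mAm mr'); last by move=> x; rewrite /= lee_fin.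
  rewrite -(integral_mixture_component mTheta dTheta PiTheta alpha0 PiE)//.
  - by apply: eq_integral => x _; rewrite -EFinM mulrCA.
  - by apply/measurable_EFinP; exact: measurable_funM.
  - by move=> x; rewrite lee_fin !mulr_ge0.
have scale c : 0 <= c ->
    (\int[PiM m]_(x in A) (c * (r x * q (T x) y))%:E =
     c%:E * \int[PiM m]_(x in A) (r x * q (T x) y)%:E)%E.
  move=> c0; rewrite -ge0_integralZl_EFin//.
  - by move=> x _; rewrite lee_fin mulr_ge0.
  - by apply/measurable_EFinP; exact: measurable_funTS.
rewrite !scale// => /(congr1 (mule (w m)^-1%:E)).
rewrite muleA -EFinM mulVf ?gt_eqF// mul1e => ->.
by rewrite !muleA -!EFinM invfM; congr (_%:E * _)%E; lra.
Qed.

(** * From component integrals to the mixture *)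

(** This is [ln t <= t - 1] at [t = z / x], multiplied by [x]: the termwise form of Gibbs'
    inequality. *)
Lemma ln_div_ge {R : realType} (x z : R) : 0 < x -> 0 < z ->
  x - z <= x * (ln x - ln z).
Proof.
move=> x0 z0; have := @le_ln1Dx R (z / x - 1).
rewrite ltrBDr addNr divr_gt0// => /(_ isT).
rewrite addrC subrK ln_div ?posrE// -(ler_pM2l x0) !mulrBr mulr1.
by rewrite [X in _ <= X - _]mulrCA divff ?gt_eqF// mulr1; lra.
Qed.

(** A difference of extended reals is finite only if both terms are. *)
Lemma integrable_of_fin_num {d} {Th : measurableType d} {R : realType}
    {P : {measure set Th -> \bar R}} {f : Th -> \bar R} :
  measurable_fun [set: Th] f -> (\int[P]_x f x)%E \is a fin_num ->
  P.-integrable [set: Th] f.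
Proof.
move=> mf; rewrite integralE fin_numB => /andP[fp fn].
by apply: integrable_funeposneg => //; rewrite ltey_eq ?fp ?fn.
Qed.

Lemma integralB_cst {d} {Th : measurableType d} {R : realType}
    {P : probability Th R} {f : Th -> R} {c : R} :
  P.-integrable [set: Th] (EFin \o f) ->
  (\int[P]_x (f x - c)%:E = \int[P]_x (f x)%:E - c%:E)%E.
Proof.
move=> fi; under eq_integral do rewrite EFinB.
rewrite integralB//; last exact: finite_measure_integrable_cst.
congr (_ - _)%E; rewrite integral_cst//.
by rewrite [X in (_ * X)%E](@probability_setT _ _ _ P) mule1.
Qed.

Lemma integrableB_cst {d} {Th : measurableType d} {R : realType}
    {P : probability Th R} {f : Th -> R} {c : R} :
  P.-integrable [set: Th] (EFin \o f) ->
  P.-integrable [set: Th] (EFin \o (fun x => f x - c)).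
Proof.
move=> fi; rewrite (_ : _ \o _ = (EFin \o f) \- (EFin \o cst c))%E//.
by apply: integrableB => //; exact: finite_measure_integrable_cst.
Qed.

Lemma integrable_mixture_component {d} {Th : measurableType d} {R : realType}
    {M : countType} {w : M -> R} {P : M -> probability Th R}
    {Q : probability Th R} {f : Th -> R} {m : M} :
  (forall k, 0 <= w k) -> is_mixture w P Q -> 0 < w m ->
  Q.-integrable [set: Th] (EFin \o f) ->
  (P m).-integrable [set: Th] (EFin \o f).
Proof.
move=> w0 QE wm /integrableP[mf fi]; apply/integrableP; split => //.
move: fi; rewrite (ge0_integral_mixture w0 QE)//; last exact: measurableT_comp.
move=> /(le_lt_trans (esum_ge_term _ m)) /=.
rewrite ltey muleC; apply: contra_neqT; rewrite -leNgt leye_eq => /eqP ->.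
by rewrite gt0_mulye// lte_fin.
Qed.

(** The differences [w m - g m] have no fixed sign. Adding the total mass 1, as the sum of [w] on
    one side and of [g] on the other, turns the claim into a termwise comparison of nonnegative
    sums. *)
Lemma mixture_integral_ge0 {d} {Th : measurableType d} {R : realType}
    {M : countType} {w g : M -> R} {P : M -> probability Th R}
    {Q : probability Th R} {f : Th -> R} :
  prob_vector w -> prob_vector g -> is_mixture w P Q ->
  Q.-integrable [set: Th] (EFin \o f) ->
  (forall m, 0 < w m ->
    ((w m - g m)%:E <= (w m)%:E * \int[P m]_x (f x)%:E)%E) ->
  (0 <= \int[Q]_x (f x)%:E)%E.
Proof.
move=> [w0 w1] [g0 g1] QE fi fm.
have mf := measurable_int Q fi.
have fpos k : (0 <= \int[P k]_x ((EFin \o f)^\+ x))%E by exact: integral_ge0.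
have fneg k : (0 <= \int[P k]_x ((EFin \o f)^\- x))%E by exact: integral_ge0.
have : (1 + \int[Q]_x ((EFin \o f)^\- x) <=
    1 + \int[Q]_x ((EFin \o f)^\+ x))%E.
  rewrite !(ge0_integral_mixture w0 QE)//; last 2 first.
  - exact: measurable_funepos.
  - exact: measurable_funeneg.
  rewrite -{1}w1 -g1 -!esumD//; try by move=> m _; rewrite ?mule_ge0 ?lee_fin.
  apply: le_esum => m _; have [wm|] := ltP 0 (w m); last first.
    move=> wm; have -> : w m = 0 by apply/eqP; rewrite eq_le wm w0.
    by rewrite !mul0e !adde0 lee_fin.
  have fim := integrable_mixture_component w0 QE wm fi.
  have := fm _ wm; rewrite [X in (_ <= _ * X)%E -> _]integralE.
  have := integrable_pos_fin_num measurableT fim.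
  have := integrable_neg_fin_num measurableT fim.
  move: (integral _ _ _) (integral _ _ _) => [u| |] [v| |]// _ _.
  by rewrite -!EFinB -!EFinM -!EFinD !lee_fin; lra.
rewrite leeD2lE// => le_np; rewrite integralE sube_ge0//.
by rewrite integrable_pos_fin_num ?orbT.
Qed.

(** In each component of positive weight the positive and negative parts have equal integrals, so
    they also do under [Q]. Finiteness of the negative part under [Q], which the components alone do
    not give, then yields integrability. *)
Lemma mixture_integral_eq0 {d} {Th : measurableType d} {R : realType}
    {M : countType} {w : M -> R} {P : M -> probability Th R}
    {Q : probability Th R} {f : Th -> R} :
  prob_vector w -> is_mixture w P Q -> measurable_fun [set: Th] f ->
  (\int[Q]_x ((EFin \o f)^\- x) < +oo)%E ->
  (forall m, 0 < w m -> (\int[P m]_x (f x)%:E = 0)%E) ->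
  Q.-integrable [set: Th] (EFin \o f) /\ (\int[Q]_x (f x)%:E = 0)%E.
Proof.
move=> [w0 w1] QE mf fn fm.
have {}mf : measurable_fun [set: Th] (EFin \o f) by exact/measurable_EFinP.
have fpn : (\int[Q]_x ((EFin \o f)^\+ x) = \int[Q]_x ((EFin \o f)^\- x))%E.
  rewrite !(ge0_integral_mixture w0 QE)//; last 2 first.
  - exact: measurable_funeneg.
  - exact: measurable_funepos.
  apply: eq_esum => m _; have [wm|] := ltP 0 (w m); last first.
    move=> wm; have -> : w m = 0 by apply/eqP; rewrite eq_le wm w0.
    by rewrite !mul0e.
  have fim : (P m).-integrable [set: Th] (EFin \o f).
    by apply: integrable_of_fin_num => //; rewrite fm.
  have := fm _ wm; rewrite [X in X = _ -> _]integralE.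
  have := integrable_pos_fin_num measurableT fim.
  have := integrable_neg_fin_num measurableT fim.
  move: (integral _ _ _) (integral _ _ _) => [u| |] [v| |]// _ _.
  by move=> /eqP; rewrite -EFinB eqe subr_eq0 => /eqP ->.
have fi : Q.-integrable [set: Th] (EFin \o f).
  by apply: integrable_funeposneg => //; rewrite fpn.
split => //; rewrite integralE fpn subee//.
by rewrite integrable_neg_fin_num.
Qed.

(** * The minimal divergence from the posterior *)

Lemma KL_singular {d} {T : measurableType d} {R : realType}
    {P Q : probability T R} : ~ P `<< Q -> KL P Q = +oo%E.
Proof. by rewrite /KL; case: pselect. Qed.

Section VariationalPosterior.
Context {R : realType} {dY dL dT : measure_display} {Yt : measurableType dY}
  {Lam : measurableType dL} {Th : measurableType dT} {M : countType}.
Context {q : Lam -> Yt -> R} {T : Th -> Lam} {y : Yt} {Theta : M -> set Th}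
  {alpha : M -> R} {PiM Xihat : M -> probability Th R}
  {Pi Post : probability Th R}.

Let p x := q (T x) y.
Let Z := fine (evidence T q y Pi).
Let D := fine (gamma_den T q y alpha PiM Xihat).
Let gamma := gammahat T q y alpha PiM Xihat.
Let vmin m := vobj T q y (Xihat m) (PiM m).

Hypotheses (mp : measurable_fun [set: Th] p) (p_ge0 : forall x, 0 <= p x).
Hypotheses (mTheta : forall m, measurable (Theta m))
  (dTheta : trivIset [set: M] Theta).
Hypotheses (alpha_ge0 : forall m, 0 <= alpha m)
  (PiTheta : forall m, PiM m (Theta m) = 1%E) (PiE : is_mixture alpha PiM Pi).
Hypothesis (evidence_gt0 : (0 < evidence T q y Pi < +oo)%E).
Hypothesis (PostE : is_posterior T q y Pi Post).
Hypothesis (gamma_den_gt0 : (0 < gamma_den T q y alpha PiM Xihat < +oo)%E).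

Let Z_gt0 : 0 < Z. Proof. exact: fine_gt0. Qed.

Let D_gt0 : 0 < D. Proof. exact: fine_gt0. Qed.

Let gamma_term_ge0 m : (0 <= (alpha m)%:E * expeR (- vmin m))%E.
Proof. by rewrite mule_ge0 ?lee_fin ?expeR_ge0. Qed.

Let gamma_term_fin m : ((alpha m)%:E * expeR (- vmin m))%E \is a fin_num.
Proof.
rewrite ge0_fin_numE//; case/andP: gamma_den_gt0 => _; apply: le_lt_trans.
exact: (esum_ge_term (fun k => (alpha k)%:E * expeR (- vmin k))%E).
Qed.

(** At [-oo] the exponential would be [+oo], and so would the normalising sum. *)
Lemma vobj_neqNy m : 0 < alpha m -> vmin m != -oo%E.
Proof.
move=> am; have := gamma_term_fin m; apply: contraTN => /eqP ->.
by rewrite /= gt0_muley ?lte_fin.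
Qed.

Lemma prob_vector_gammahat : prob_vector gamma.
Proof.
split=> [m|].
  by apply: divr_ge0; [exact/fine_ge0/gamma_term_ge0|exact: ltW].
transitivity (\esum_(m in [set: M])
    (D^-1)%:E * ((alpha m)%:E * expeR (- vmin m)))%E.
  apply: eq_esum => m _.
  rewrite -[X in _ = (_ * X)%E](fineK (gamma_term_fin m)).
  by rewrite -EFinM mulrC.
rewrite esumZl ?invr_ge0 ?ltW// -/(gamma_den T q y alpha PiM Xihat).
rewrite -[X in (_ * X)%E]fineK ?ge0_fin_numE ?esum_ge0//; last first.
  by case/andP: gamma_den_gt0.
by rewrite -EFinM mulVf// gt_eqF.
Qed.

Lemma gammahatE m v : vmin m = v%:E -> gamma m = alpha m * expR (- v) / D.
Proof. by rewrite /gamma /gammahat -/(vmin m) => ->. Qed.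

(** The value [+oo] would give weight zero, and [vobj_neqNy] excludes [-oo]. *)
Lemma gammahat_gt0 m : 0 < gamma m ->
  0 < alpha m /\ exists v, vmin m = v%:E.
Proof.
rewrite /gamma /gammahat -/(vmin m) => gm.
have am : 0 < alpha m.
  rewrite lt_neqAle alpha_ge0 andbT eq_sym; apply: contraTneq gm => ->.
  by rewrite mul0e mul0r ltxx.
split => //; move: gm (vobj_neqNy m am); case: (vmin m) => [v| |]//.
  by exists v.
by rewrite /= mulr0 mul0r ltxx.
Qed.

(** If [alpha m] vanished, so would the density of [P m], contradicting its mass 1. The identity is
    [vobj_log_density] with [k = alpha m / (w m * Z)]; its finiteness conditions pass from a mixture
    to each component of positive weight. *)
Lemma mixture_log_component {w : M -> R} {P : M -> probability Th R}
    {Xi : probability Th R} {r : Th -> R} {m : M} :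
  (forall k, 0 <= w k) -> (forall k, P k (Theta k) = 1%E) ->
  is_mixture w P Xi -> is_density r Xi Post -> 0 < w m ->
  0 < alpha m /\
  (vobj T q y (P m) (PiM m) != -oo%E ->
   (\int[P m]_x (ln (r x))%:E =
    vobj T q y (P m) (PiM m) - (ln (alpha m) - ln (w m) - ln Z)%:E)%E).
Proof.
move=> w0 PTheta XiE dr wm.
have dP := component_density mp p_ge0 mTheta dTheta PiTheta PTheta alpha_ge0 w0
  PiE XiE PostE dr wm.
have am : 0 < alpha m.
  rewrite lt_neqAle alpha_ge0 andbT; apply/eqP => am0.
  case: dP => _ _ /(_ _ measurableT); rewrite probability_setT.
  under eq_integral do rewrite -am0 !mul0r.
  by rewrite integral0 => /eqP; rewrite eqe oner_eq0.
split => // v_fin.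
have -> : ln (alpha m) - ln (w m) - ln Z = ln (alpha m / (w m * Z)).
  by rewrite ln_div ?lnM ?posrE ?mulr_gt0// opprD addrA.
have [mr r0 _] := dr.
apply: vobj_log_density => //.
- have mpE : measurable_fun [set: Th] (EFin \o p) by exact/measurable_EFinP.
  have [_] := andP evidence_gt0; rewrite /evidence.
  rewrite (ge0_integral_mixture alpha_ge0 PiE measurableT mpE); last first.
    by move=> x; rewrite lee_fin p_ge0.
  move=> /(le_lt_trans (esum_ge_term _ m)) /=.
  rewrite !ltey muleC; apply: contra_neq => ->.
  by rewrite gt0_mulye// lte_fin.
- by rewrite divr_gt0// mulr_gt0.
have := density_ln_neg_lty dr.
rewrite (ge0_integral_mixture w0 XiE)//; last first.
  apply: measurable_funeneg; apply/measurable_EFinP.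
  exact: (measurableT_comp (@measurable_ln R) mr).
move=> /(le_lt_trans (esum_ge_term _ m)) /=.
rewrite !ltey muleC; apply: contra_neq => ->.
by rewrite gt0_mulye// lte_fin.
Qed.

Lemma KL_mixture_ge {w : M -> R} {P : M -> probability Th R}
    {Xi : probability Th R} :
  prob_vector w -> (forall k, P k (Theta k) = 1%E) -> is_mixture w P Xi ->
  (forall m, (vmin m <= vobj T q y (P m) (PiM m))%E) ->
  ((ln Z - ln D)%:E <= KL Xi Post)%E.
Proof.
move=> pw PTheta XiE vmin_le; have [w0 w1] := pw.
have [XiPost|nXiPost] := pselect (Xi `<< Post); last first.
  by rewrite KL_singular// leey.
have [r dr] := density_exists XiPost; have [mr r0 _] := dr.
rewrite (KL_density dr); set c := ln Z - ln D.
have ml : measurable_fun [set: Th] (EFin \o (@ln R \o r)).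
  by apply/measurable_EFinP; exact: (measurableT_comp (@measurable_ln R) mr).
have ln_neg := density_ln_neg_lty dr.
have [ln_pos|ln_pos] := boolP
    (\int[Xi]_x ((EFin \o (@ln R \o r))^\+ x) < +oo)%E; last first.
  by rewrite (integral_eqy ln_pos ln_neg) leey.
have li := integrable_funeposneg ml ln_pos ln_neg.
(* Subtracting [c] under the integral reduces the claim to nonnegativity, hence to a bound by
   [w m - gamma m] in each component. *)
rewrite -sube_ge0// -integralB_cst//.
apply: (mixture_integral_ge0 pw prob_vector_gammahat XiE).
  exact: integrableB_cst.
move=> m wm; have lim := integrable_mixture_component w0 XiE wm li.
have lfin := integrable_fin_num measurableT lim.
have [am lnE] := mixture_log_component w0 PTheta XiE dr wm.
have v_neqNy : vobj T q y (P m) (PiM m) != -oo%E.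
  rewrite -ltNye (lt_le_trans _ (vmin_le m))// ltNye; exact: vobj_neqNy.
rewrite integralB_cst// lnE//.
(* Integrability of [ln r] under [P m] excludes the objective [+oo]; then [vmin m], which lies below
   it and is not [-oo], is finite too. *)
move: lfin (vmin_le m) (vobj_neqNy m am); rewrite /= lnE//.
case: (vobj T q y (P m) (PiM m)) v_neqNy => [u| |]// _ _.
case vmE : (vmin m) => [v| |]//; rewrite lee_fin => vu _.
have gE := gammahatE m v vmE.
have gm : 0 < gamma m by rewrite gE divr_gt0// mulr_gt0// expR_gt0.
rewrite -!EFinB -EFinM lee_fin.
apply: (le_trans (ln_div_ge _ _ wm gm)); rewrite ler_wpM2l//.
rewrite gE ln_div ?lnM ?posrE ?expR_gt0 ?mulr_gt0 ?expR_gt0// expRK /c; lra.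
Qed.

(** On a [Post]-null set the likelihood vanishes [PiM m]-almost everywhere, hence [Xihat m]-almost
    everywhere when [gamma m] is positive. But a finite objective makes the likelihood positive
    [Xihat m]-almost everywhere, so the set is [Xihat m]-null. *)
Lemma gammahat_mixture_dominates {Xi : probability Th R} :
  is_mixture gamma Xihat Xi -> Xi `<< Post.
Proof.
move=> XiE; apply/null_content_dominatesP => A mA PostA.
rewrite XiE//; apply: esum1 => m _.
have [gm|gm] := ltP 0 (gamma m); last first.
  have -> : gamma m = 0.
    by apply/eqP; rewrite eq_le gm; case: prob_vector_gammahat => ->.
  by rewrite mul0e.
have [am [v vE]] := gammahat_gt0 m gm.
have [KLfin qfin] : KL (Xihat m) (PiM m) != +oo%E /\
    (\int[Xihat m]_x elog (p x))%E \is a fin_num.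
  move: vE; rewrite /vmin /vobj -/p.
  by case: (KL _ _) (\int[_]_x _)%E => [a| |] [b| |].
have XiPi : Xihat m `<< PiM m.
  by apply: contrapT => /KL_singular XiPi; move: KLfin; rewrite XiPi.
have melog : measurable_fun [set: Th] (fun x => elog (p x)).
  exact: (measurableT_comp measurable_elog mp).
have ae_p : {ae Xihat m, forall x, 0 < p x}.
  (* An integrable function is finite almost everywhere, and [elog] is [-oo] where the likelihood
     vanishes. *)
  have := integrable_ae measurableT (integrable_of_fin_num melog qfin).
  by apply: filterS => x /(_ I); rewrite /elog; case: ifP.
have intp : (\int[PiM m]_(x in A) (p x)%:E = 0)%E.
  have [_ _ PostE'] := posterior_density mp p_ge0 PostE.
  have mZp : measurable_fun [set: Th] (EFin \o (fun x => Z^-1 * p x)).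
    by apply/measurable_EFinP; exact: measurable_funM.
  have sum0 : (\int[Pi]_(x in A) (Z^-1 * p x)%:E = 0)%E by rewrite -PostE'.
  rewrite (ge0_integral_mixture alpha_ge0 PiE mA mZp) in sum0; last first.
    by move=> x; rewrite lee_fin mulr_ge0// invr_ge0 ltW.
  have := esum_ge_term (fun k => (alpha k)%:E *
    \int[PiM k]_(x in A) (Z^-1 * p x)%:E)%E m.
  rewrite sum0 => le0.
  have : ((alpha m * Z^-1)%:E * \int[PiM m]_(x in A) (p x)%:E <= 0)%E.
    rewrite EFinM -muleA -ge0_integralZl_EFin ?invr_ge0 ?(ltW Z_gt0)//.
    + by move=> x _; rewrite lee_fin.
    + by apply/measurable_EFinP; exact: measurable_funTS.
  rewrite pmule_rle0 ?lte_fin ?divr_gt0// => int_le0.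
  apply/eqP; rewrite eq_le int_le0 integral_ge0// => x _.
  by rewrite lee_fin.
have ae_p0 : ae_eq (PiM m) A (EFin \o p) (cst 0%E).
  apply/(ae_eq_integral_abs (PiM m) mA); last first.
    by rewrite -intp; apply: eq_integral => x _; rewrite gee0_abs// lee_fin.
  by apply/measurable_EFinP; exact: measurable_funTS.
have : {ae Xihat m, forall x, ~ A x}.
  apply: filterS2 ae_p (null_dominates_ae_eq mA XiPi ae_p0) => x px p0 /p0 [p0'].
  by move: px; rewrite p0' ltxx.
move=> XiA; rewrite (measure_negligible mA) ?mule0//.
by apply: negligibleS XiA => x Ax /=; apply.
Qed.

(** Substituting [ln (gamma m) = ln (alpha m) - vmin m - ln D] cancels [vmin m] and [alpha m], so
    [ln r] has the same mean [c] in every component of positive weight. *)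
Lemma KL_gammahat_mixture {Xi : probability Th R} :
  (forall k, Xihat k (Theta k) = 1%E) -> is_mixture gamma Xihat Xi ->
  KL Xi Post = (ln Z - ln D)%:E.
Proof.
move=> XTheta XiE; have pg := prob_vector_gammahat; have [g0 g1] := pg.
have [r dr] := density_exists (gammahat_mixture_dominates XiE).
have [mr r0 _] := dr.
set c := ln Z - ln D; pose F x := ln (r x) - c.
have mln : measurable_fun [set: Th] (@ln R \o r).
  exact: (measurableT_comp (@measurable_ln R) mr).
have mF : measurable_fun [set: Th] F by exact: measurable_funB.
(* Shifting by [c] increases the negative part of [ln r] by at most [|c|]. *)
have Fneg : (\int[Xi]_x ((EFin \o F)^\- x) < +oo)%E.
  apply: (@le_lt_trans _ _
      (\int[Xi]_x ((EFin \o (@ln R \o r))^\- x + `|c|%:E))%E).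
    apply: ge0_le_integral => //.
    - exact/measurable_funeneg/measurable_EFinP.
    - by apply: emeasurable_funD => //; exact/measurable_funeneg/measurable_EFinP.
    move=> x _; rewrite !funerneg -EFinD lee_fin /funrneg /F /= opprB.
    have c1 := ler_norm c; have c0 := normr_ge0 c.
    have l1 : - ln (r x) <= Num.max (- ln (r x)) 0 by rewrite le_max lexx.
    have l0 : 0 <= Num.max (- ln (r x)) 0 by rewrite le_max lexx orbT.
    by rewrite ge_max; apply/andP; split; lra.
  rewrite ge0_integralD//.
    rewrite integral_cst// [X in (_ + _ * X)%E](@probability_setT _ _ _ Xi) mule1.
    by rewrite lte_add_pinfty ?ltry//; exact: density_ln_neg_lty dr.
  exact/measurable_funeneg/measurable_EFinP.
have F0 m : 0 < gamma m -> (\int[Xihat m]_x (F x)%:E = 0)%E.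
  move=> gm; have [am [v vE]] := gammahat_gt0 m gm.
  have [_] := mixture_log_component g0 XTheta XiE dr gm.
  rewrite -/(vmin m) vE => /(_ isT) lnE.
  rewrite integralB_cst; last first.
    by apply: integrable_of_fin_num; [exact/measurable_EFinP|rewrite /= lnE].
  rewrite lnE -!EFinB; congr EFin.
  rewrite (gammahatE m v vE) ln_div ?lnM ?posrE ?expR_gt0 ?mulr_gt0 ?expR_gt0//.
  by rewrite expRK /c; lra.
have [iF intF] := mixture_integral_eq0 pg XiE mF Fneg F0.
rewrite (KL_density dr).
transitivity (\int[Xi]_x (F x - (- c))%:E)%E.
  by apply: eq_integral => x _; rewrite /F opprK subrK.
by rewrite integralB_cst// intF add0e EFinN oppeK.
Qed.

End VariationalPosterior.

Theorem theorem2p1 (R : realType) (dY dL dT : measure_display)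
  (Yt : measurableType dY) (Lam : measurableType dL) (Th : measurableType dT)
  (mu : {measure set Yt -> \bar R}) (hmu : sigma_finite [set: Yt] mu)
  (q : Lam -> Yt -> R) (hq0 : forall l x, 0 <= q l x)
  (hqm : measurable_fun [set: Lam * Yt] (fun p => q p.1 p.2))
  (hq1 : forall l, (\int[mu]_x (q l x)%:E = 1)%E)
  (M : countType) (Theta : M -> set Th)
  (hThm : forall m, measurable (Theta m))
  (hdisj : trivIset [set: M] Theta)
  (hcover : \bigcup_m Theta m = [set: Th])
  (T : Th -> Lam) (hT : measurable_fun [set: Th] T)
  (alpha : M -> R) (halpha : prob_vector alpha)
  (PiM : M -> probability Th R) (hPiM : forall m, PiM m (Theta m) = 1%E)
  (Pi : probability Th R) (hPi : is_mixture alpha PiM Pi)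
  (V : M -> set (probability Th R))
  (hV : forall m Xi, V m Xi -> Xi (Theta m) = 1%E)
  (y : Yt)
  (hZ : (0 < evidence T q y Pi < +oo)%E)
  (Post : probability Th R) (hPost : is_posterior T q y Pi Post)
  (Xihat : M -> probability Th R)
  (hXihatV : forall m, V m (Xihat m))
  (hXihat_min : forall m Xi, V m Xi ->
     (vobj T q y (Xihat m) (PiM m) <= vobj T q y Xi (PiM m))%E)
  (hden : (0 < gamma_den T q y alpha PiM Xihat < +oo)%E) :
  (exists Xin : probability Th R,
     is_mixture (gammahat T q y alpha PiM Xihat) Xihat Xin) /\
  (forall Xin : probability Th R,
     is_mixture (gammahat T q y alpha PiM Xihat) Xihat Xin ->
     var_family V Xin /\
     (forall Xi, var_family V Xi -> (KL Xin Post <= KL Xi Post)%E)).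
Proof.
have mTy : measurable_fun [set: Th] (fun x => (T x, y)).
  exact: measurable_fun_pair.
have mp := measurableT_comp hqm mTy.
have p0 x : 0 <= q (T x) y by exact: hq0.
have [a0 _] := halpha.
have XTheta m : Xihat m (Theta m) = 1%E by exact: hV (hXihatV m).
have pg := prob_vector_gammahat a0 hden.
split; first exact: mixture_exists.
move=> Xin XinE; split.
  by exists (gammahat T q y alpha PiM Xihat), Xihat.
move=> Xi [w [P [pw VP XiE]]].
(* The candidate attains [ln Z - ln D], the lower bound valid for every member of the family. *)
rewrite (KL_gammahat_mixture mp p0 hThm hdisj a0 hPiM hPi hZ hPost hden)//.
apply: (KL_mixture_ge mp p0 hThm hdisj a0 hPiM hPi hZ hPost hden pw _ XiE).
- by move=> m; exact: hV (VP m).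
- by move=> m; exact: hXihat_min.
Qed.
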